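(* Let $p\ge 1$, let $F=f+\psi$ be as in the context, with $p$th derivative of $f$ Lipschitz continuous with constant $L_p$, and let $D<+\infty$. Let the inner accuracies be chosen according to the rule $$\delta_k := \frac{c}{k^{p+1}},\qquad k\ge 1,$$ with some $c\ge 0$. Then for the sequence $\{x_k\}_{k\ge 1}$ produced by Monotone Inexact Tensor Method I (described in the context) we have, for all $k\ge 1$, $$F(x_k)-F^* \;\le\; \frac{(p+1)^{p+1}L_pD^{p+1}}{p!\,k^p}+\frac{c}{k^p}.$$
   Context: Setting. $\mathbb{E}$ is a finite-dimensional real vector space with dual $\mathbb{E}^*$, and $\langle s,x\rangle$ is the value of $s\in\mathbb{E}^*$ at $x\in\mathbb{E}$. $B:\mathbb{E}\to\mathbb{E}^*$ is a fixed symmetric positive definite linear operator and $\|x\|=\langle Bx,x\rangle^{1/2}$. For a $p$-linear symmetric form, $\|D^pf(x)\|=\max_{\|h_i\|\le 1}D^pf(x)[h_1,\dots,h_p]$; $D^kf(x)[h]^k$ denotes the $k$th directional derivative along $h$ taken $k$ times. Problem: minimize $F(x)=f(x)+\psi(x)$ over $x\in\mathbb{E}$, where $\psi:\mathbb{E}\to\mathbb{R}\cup\{+\infty\}$ is proper closed convex and $f:\operatorname{dom}\psi\to\mathbb{R}$ is convex and (sufficiently many times, at least $p$ times) differentiable. A solution $x^*\in\operatorname{dom}\psi$ is assumed to exist and is fixed; $F^*=F(x^* )$. Lipschitz assumption: $\|D^pf(x)-D^pf(y)\|\le L_p\|x-y\|$ for all $x,y\in\operatorname{dom}\psi$. Model: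 for $H\ge 0$, $$\Omega_H(x;y)=f(x)+\sum_{k=1}^p\frac1{k!}D^kf(x)[y-x]^k+\frac{H\|y-x\|^{p+1}}{(p+1)!}+\psi(y).$$ Inexact $\delta$-step: $T_{H,\delta}(x)$ denotes any point $T\in\operatorname{dom}\psi$ with $\Omega_H(x;T)-\min_y\Omega_H(x;y)\le\delta$. Monotone Inexact Tensor Method I: choose $x_0\in\operatorname{dom}\psi$, fix $H:=pL_p$. For $k=0,1,2,\dots$: given $\delta_{k+1}\ge0$, compute $T_{k+1}:=T_{H,\delta_{k+1}}(x_k)$; if $F(T_{k+1})<F(x_k)$ set $x_{k+1}:=T_{k+1}$, otherwise set $x_{k+1}:=x_k$. Radius of the initial level set: $D=\sup_x\{\|x-x^*\| : F(x)\le F(x_0)\}$. *)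

(* Defs.v *)
From HB Require Import structures.
From mathcomp Require Import all_boot all_order all_algebra perm.
From mathcomp Require Import all_classical all_reals all_analysis.

Set Implicit Arguments.
Unset Strict Implicit.
Unset Printing Implicit Defensive.

Import Order.TTheory GRing.Theory Num.Theory.
Local Open Scope classical_set_scope.
Local Open Scope ring_scope.

Definition self_adjoint {R : realType} {E : vectType R}
    (B : 'Hom(E, 'Hom(E, R^o))) : Prop :=
  forall x y : E, B x y = B y x.

Definition positive_definite {R : realType} {E : vectType R}
    (B : 'Hom(E, 'Hom(E, R^o))) : Prop :=
  forall x : E, x != 0 -> 0 < (B x x : R).

(* E carries no topology of its own: as all norms on a finite-dimensional space
   are equivalent, closedness and differentiability are stated with Bnorm. *)
Definition Bnorm {R : realType} {E : vectType R}
    (B : 'Hom(E, 'Hom(E, R^o))) (x : E) : R :=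
  Num.sqrt (B x x : R).

Definition effective_domain {R : realType} {E : vectType R} (psi : E -> \bar R) : set E :=
  [set x | (psi x < +oo)%E].

Definition proper_ext {R : realType} {E : vectType R} (psi : E -> \bar R) : Prop :=
  (forall x, (-oo < psi x)%E) /\ effective_domain psi !=set0.

(* The product 0 * +oo is 0 in \bar R. *)
Definition convex_ext {R : realType} {E : vectType R}
    (psi : E -> \bar R) : Prop :=
  forall (x y : E) (t : R), 0 <= t <= 1 ->
    (psi (t *: x + (1 - t) *: y)%R <= t%:E * psi x + (1 - t)%:E * psi y)%E.

Definition epigraph {R : realType} {E : vectType R} (psi : E -> \bar R) :
    set (E * R) :=
  [set z | (psi z.1 <= z.2%:E)%E].

(* The complement of the epigraph is open in E * R. *)
Definition closed_ext {R : realType} {E : vectType R}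
    (B : 'Hom(E, 'Hom(E, R^o))) (psi : E -> \bar R) : Prop :=
  forall (x : E) (a : R), ~ epigraph psi (x, a) ->
    exists2 r : R, 0 < r &
      forall (y : E) (b : R), Bnorm B (y - x) < r -> `|b - a| < r ->
        ~ epigraph psi (y, b).

Definition kform {R : realType} (E : vectType R) (k : nat) : Type :=
  ('I_k -> E) -> R.

Definition multilinear {R : realType} {E : vectType R} {k : nat}
    (A : kform E k) : Prop :=
  forall (i : 'I_k) (h : 'I_k -> E), scalar (fun u => A [eta h with i |-> u]).

Definition symmetric_kform {R : realType} {E : vectType R} {k : nat}
    (A : kform E k) : Prop :=
  forall (s : {perm 'I_k}) (h : 'I_k -> E), A (h \o s) = A h.

(* For k >= 1 replacing one h i by its opposite negates A h, so no absolute value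
   is needed; the supremum is attained, the unit ball being compact. *)
Definition kform_norm {R : realType} {E : vectType R}
    (B : 'Hom(E, 'Hom(E, R^o))) {k : nat} (A : kform E k) : \bar R :=
  ereal_sup [set (A h)%:E | h in [set h | forall i, Bnorm B (h i) <= 1]].

Definition ord_cons {T : Type} {k : nat} (v : T) (h : 'I_k -> T) :
    'I_k.+1 -> T :=
  fun i => if unlift ord0 i is Some j then h j else v.

(* D k.+1 x is a Frechet derivative of D k at x relative to X:
     || D k y - D k x - D k.+1 x [y - x, ...] || = o(|| y - x ||)
   as y tends to x inside X.  If X is open this is the usual derivative; in
   general f need not be defined, nor differentiable, outside X. *)
Definition derivative_within {R : realType} {E : vectType R}
    (B : 'Hom(E, 'Hom(E, R^o))) (X : set E) {k : nat}
    (A : E -> kform E k) (x : E) (A' : kform E k.+1) : Prop :=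
  forall eps : R, 0 < eps -> exists2 r : R, 0 < r &
    forall y : E, X y -> Bnorm B (y - x) < r ->
    forall h : 'I_k -> E, (forall i, Bnorm B (h i) <= 1) ->
      `|A y h - A x h - A' (ord_cons (y - x) h)| <= eps * Bnorm B (y - x).

(* f is p times differentiable on X, and D k x is its kth derivative at x. *)
Definition derivatives_upto {R : realType} {E : vectType R}
    (B : 'Hom(E, 'Hom(E, R^o))) (X : set E) (f : E -> R) (p : nat)
    (D : forall k : nat, E -> kform E k) : Prop :=
  [/\ forall x, X x -> forall h, D 0%N x h = f x,
      forall k x, (k <= p)%N -> X x ->
        multilinear (D k x) /\ symmetric_kform (D k x) &
      forall k x, (k < p)%N -> X x ->
        derivative_within B X (D k) x (D k.+1 x)].

Definition lipschitz_derivative {R : realType} {E : vectType R}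
    (B : 'Hom(E, 'Hom(E, R^o))) (X : set E) (p : nat)
    (Dp : E -> kform E p) (Lp : R) : Prop :=
  forall x y : E, X x -> X y ->
    (kform_norm B (fun h => (Dp x h - Dp y h)%R)
       <= (Lp * Bnorm B (x - y))%:E)%E.

(* Only the values of f on effective_domain psi matter. *)
Definition objective {R : realType} {E : vectType R}
    (f : E -> R) (psi : E -> \bar R) (x : E) : \bar R :=
  ((f x)%:E + psi x)%E.

Definition is_solution {R : realType} {E : vectType R}
    (f : E -> R) (psi : E -> \bar R) (xs : E) : Prop :=
  effective_domain psi xs /\ forall y, (objective f psi xs <= objective f psi y)%E.

Definition model {R : realType} {E : vectType R}
    (B : 'Hom(E, 'Hom(E, R^o))) (f : E -> R) (psi : E -> \bar R) (p : nat)
    (D : forall k : nat, E -> kform E k) (H : R) (x y : E) : \bar R :=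
  ((f x + \sum_(1 <= k < p.+1) (k`!%:R)^-1 * D k x (fun=> y - x)
    + H * Bnorm B (y - x) ^+ p.+1 / (p.+1)`!%:R)%:E + psi y)%E.

(* The minimum of the model is written as an infimum, with which it agrees
   whenever it is attained. *)
Definition inexact_step {R : realType} {E : vectType R}
    (B : 'Hom(E, 'Hom(E, R^o))) (f : E -> R) (psi : E -> \bar R) (p : nat)
    (D : forall k : nat, E -> kform E k) (H delta : R) (x T : E) : Prop :=
  effective_domain psi T /\
  (model B f psi p D H x T - ereal_inf (range (model B f psi p D H x))
     <= delta%:E)%E.

(* T 0 is not used. *)
Definition monotone_inexact_tensor_method_I {R : realType} {E : vectType R}
    (B : 'Hom(E, 'Hom(E, R^o))) (f : E -> R) (psi : E -> \bar R) (p : nat)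
    (D : forall k : nat, E -> kform E k) (Lp : R) (delta : nat -> R)
    (x T : nat -> E) : Prop :=
  effective_domain psi (x 0%N) /\
  forall k : nat,
    inexact_step B f psi p D (p%:R * Lp) (delta k.+1) (x k) (T k.+1) /\
    x k.+1 = (if (objective f psi (T k.+1) < objective f psi (x k))%E
              then T k.+1 else x k).

Definition level_set_radius {R : realType} {E : vectType R}
    (B : 'Hom(E, 'Hom(E, R^o))) (f : E -> R) (psi : E -> \bar R)
    (x0 xs : E) : \bar R :=
  ereal_sup [set (Bnorm B (x - xs))%:E |
             x in [set x | (objective f psi x <= objective f psi x0)%E]].

(* Main.v *)
(* Taylor's formula along segments of the domain bounds the gap between f and its
   p-th Taylor polynomial by Lp |y - x|^(p+1) / (p+1)!, so that with H = p Lp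
     F(T) <= Omega_H(x; T) <= F(y) + Lp |y - x|^(p+1) / p! + delta
   for every y in the domain.  Taking y = (1 - t) x_k + t x^* gives
     F(x_{k+1}) - F^* <= (1 - t) (F(x_k) - F^* ) + t^(p+1) Lp D^(p+1) / p! + delta_{k+1}.
   With 1 - t = (k / (k + 1))^(p+1), multiplying by (k + 1)^(p+1) makes the first term
   telescope, and Bernoulli's inequality t <= (p + 1) / (k + 1) bounds each of the other
   two terms by a constant. *)

Require Import Defs.
From mathcomp Require Import all_boot all_order all_algebra.
From mathcomp Require Import all_classical all_reals all_analysis.
From mathcomp Require Import ring lra.

Import Order.TTheory GRing.Theory Num.Theory.
Import numFieldNormedType.Exports.
Local Open Scope classical_set_scope.
Local Open Scope ring_scope.

(** * One-variable Taylor upper bound on a segment *)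

(** The derivative is relative to [[0, N]], hence one-sided at the endpoints: this is what
    [derivative_within] yields along a segment of the domain. *)
Definition derivative_on {R : realType} (N : R) (g dg : R -> R) : Prop :=
  forall t, 0 <= t <= N -> forall eps : R, 0 < eps -> exists2 r : R, 0 < r &
    forall s, 0 <= s <= N -> `|s - t| < r ->
      `|g s - g t - dg t * (s - t)| <= eps * `|s - t|.

Lemma derivative_on_continuous {R : realType} (N : R) (g dg : R -> R) :
  derivative_on N g dg -> {within `[0, N], continuous g}.
Proof.
move=> gD; apply/subspace_continuousP => t /=; rewrite in_itv/= => tN.
apply/cvgrPdist_le => e e0.
have [r r0 gr] := gD t tN 1 ltr01.
have d0 : 0 < 1 + `|dg t| by rewrite ltr_pwDl.
rewrite near_withinE; apply/nbhs_ballP.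
exists (Num.min r (e / (1 + `|dg t|))) => /=; first by rewrite lt_min r0 divr_gt0.
move=> s; rewrite /ball/= lt_min distrC => /andP[sr se]; rewrite in_itv/= => sN.
have := gr s sN sr; rewrite mul1r => gst.
rewrite distrC -[g s - g t](subrK (dg t * (s - t))).
rewrite (le_trans (ler_normD _ _))// normrM.
rewrite (le_trans (lerD gst (lexx _)))// -{1}[`|s - t|]mul1r -mulrDl.
by rewrite mulrC -ler_pdivlMr// ltW.
Qed.

Lemma derivative_on_is_derive {R : realType} (N : R) (g dg : R -> R) (t : R) :
  derivative_on N g dg -> t \in `]0, N[ -> is_derive t (1 : R) g (dg t).
Proof.
rewrite in_itv/= => gD /andP[t0 tN].
have cvg_g : (fun h => h^-1 *: (g (h *: (1 : R) + t) - g t)) @ 0^' --> dg t.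
  apply/cvgrPdist_le => e e0.
  have tN' : 0 <= t <= N by rewrite !ltW.
  have [r r0 gr] := gD t tN' e e0.
  apply/nbhs_ballP; exists (Num.min r (Num.min t (N - t))) => /=.
    by rewrite !lt_min r0 t0 subr_gt0.
  move=> h; rewrite /ball/= sub0r normrN !lt_min => /and3P[hr ht hN] h0.
  have hE : h *: (1 : R) = h by rewrite /GRing.scale/= mulr1.
  rewrite hE; have := gr (h + t); rewrite addrK; move=> /(_ _ hr) H.
  have {}H : `|g (h + t) - g t - dg t * h| <= e * `|h|.
    by apply: H; move: ht hN; rewrite !ltr_norml => /andP[? ?] /andP[? ?]; lra.
  rewrite /GRing.scale/= distrC -(ler_pM2r (_ : 0 < `|h|)) ?normr_gt0//.
  by rewrite -normrM mulrBl mulrAC mulVf// mul1r.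
split; first by apply/cvg_ex; exists (dg t).
exact/cvg_lim.
Qed.

(** [q - g] has a nonnegative derivative inside the segment and is continuous up to its endpoints,
    so it stays above its value at 0. *)
Lemma derivative_on_le_poly {R : realType} (N : R) (g dg : R -> R) (q : {poly R}) :
  derivative_on N g dg -> (forall t, 0 <= t <= N -> dg t <= q^`().[t]) ->
  g 0 <= q.[0] -> forall t, 0 <= t <= N -> g t <= q.[t].
Proof.
move=> gD dgq g0q t /andP[t0 tN].
pose r : R -> R := horner q - g.
have dr s : s \in `]0, N[ -> is_derive s (1 : R) r (q^`().[s] - dg s).
  move=> sN; have := is_derive_poly q s.
  have := derivative_on_is_derive _ _ _ _ gD sN => ? ?.
  exact: is_deriveB.
have : r 0 <= r t; last first.
  by rewrite /r !fctE => h; move: g0q h; lra.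
apply: (@ger0_derive1_ndecr _ r 0 N) => //.
- by move=> s /dr [].
- move=> s sN; rewrite derive1E; have [_ ->] := dr s sN.
  by rewrite subr_ge0 dgq//; move: sN; rewrite in_itv/= => /andP[? ?]; rewrite !ltW.
- apply: within_continuousB; last exact: derivative_on_continuous gD.
  by apply: derivable_within_continuous => s _; exact: derivable_horner.
Qed.

(** The affine bound on [g p], whose slope [a p.+1] will be the Lipschitz constant, is integrated
    [p] times through [derivative_on_le_poly]. *)
Lemma taylor_le {R : realType} (N : R) (p : nat) (g : nat -> R -> R) (a : nat -> R) :
  (forall k, (k < p)%N -> derivative_on N (g k) (g k.+1)) ->
  (forall k, (k < p)%N -> g k 0 = a k) ->
  (forall t, 0 <= t <= N -> g p t <= a p + a p.+1 * t) ->
  forall t, 0 <= t <= N -> g 0%N t <= \sum_(k < p.+2) a k * t ^+ k / k`!%:R.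
Proof.
move=> gD ga gp t tN.
suff : g 0%N t <= (\poly_(k < p.+2) (a k / k`!%:R)).[t].
  rewrite horner_poly => /le_trans; apply; rewrite le_eqVlt; apply/orP; left.
  by apply/eqP/eq_bigr => k _; rewrite mulrAC.
elim: p g a gD ga gp t tN => [|p IHp] g a gD ga gp t tN.
  rewrite horner_poly !big_ord_recr big_ord0 /= add0r expr0 expr1 !divr1 mulr1.
  exact: gp.
apply: (@derivative_on_le_poly _ N _ (g 1%N)) tN; first exact: gD.
  move=> s sN.
  (* Differentiation shifts the Taylor coefficients, giving the polynomial of the shifted family
     [g k.+1]. *)
  have -> : (\poly_(k < p.+3) (a k / k`!%:R))^`() =
            \poly_(k < p.+2) (a k.+1 / k`!%:R).
    apply/polyP => i; rewrite coef_deriv !coef_poly ltnS.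
    case: ifP => _; last by rewrite mul0rn.
    rewrite -[LHS]mulr_natr -mulrA; congr (_ * _).
    by rewrite factS natrM invfM mulrAC mulVf ?mul1r ?pnatr_eq0.
  by apply: (IHp (fun k => g k.+1)) => // k kp; [exact: gD | exact: ga].
by rewrite horner_coef0 coef_poly /= divr1 ga.
Qed.

(** * Multilinear forms and the norm induced by [B] *)

Lemma multilinearZ {R : realType} {E : vectType R} {k : nat} (A : kform E k)
    (i : 'I_k) (h : 'I_k -> E) (a : R) (u : E) :
  multilinear A -> A [eta h with i |-> a *: u] = a * A [eta h with i |-> u].
Proof.
move=> Am; have A0 : A [eta h with i |-> 0] = 0.
  by have := Am i h 1 0 0; rewrite scaler0 addr0 mul1r; lra.
by have := Am i h a u 0; rewrite addr0 A0 addr0.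
Qed.

Lemma multilinear_diagZ {R : realType} {E : vectType R} {k : nat} (A : kform E k)
    (a : R) (u : E) :
  multilinear A -> A (fun=> a *: u) = a ^+ k * A (fun=> u).
Proof.
move=> Am.
(* [h m] scales the first [m] arguments only; raising [m] by one changes a single argument and
   yields one factor [a]. *)
pose h m : 'I_k -> E := fun i => if (i < m)%N then a *: u else u.
have Ah m : (m <= k)%N -> A (h m) = a ^+ m * A (fun=> u).
  elim: m => [|m IHm] mk; first by rewrite mul1r.
  have hS : h m.+1 = [eta h m with Ordinal mk |-> a *: u].
    apply/funext => i /=; rewrite /h -val_eqE /= ltnS.
    by case: ltngtP => // ->.
  have hm : h m = [eta h m with Ordinal mk |-> u].
    apply/funext => i /=; rewrite /h -val_eqE /=.
    by case: ltngtP.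
  have := multilinearZ A (Ordinal mk) (h m) a u Am; rewrite -hS -hm => ->.
  by rewrite IHm ?(ltnW mk)// exprS mulrA.
rewrite -Ah//; congr (A _); apply/funext => i.
by rewrite /h ltn_ord.
Qed.

Lemma multilinear_ord_consZ {R : realType} {E : vectType R} {k : nat}
    (A : kform E k.+1) (a : R) (u : E) (h : 'I_k -> E) :
  multilinear A -> A (ord_cons (a *: u) h) = a * A (ord_cons u h).
Proof.
have consE v : ord_cons v h = [eta ord_cons u h with ord0 |-> v].
  apply/funext => i /=; rewrite /ord_cons.
  by case: unliftP => [j ->|->]; rewrite ?eqxx// eq_sym (negbTE (neq_lift _ _)).
  move=> Am; have := multilinearZ A ord0 (ord_cons u h) a u Am.
  by rewrite -!consE.
Qed.

Lemma ord_cons_const {T : Type} {k : nat} (u : T) :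
  ord_cons u (fun=> u) = (fun=> u) :> ('I_k.+1 -> T).
Proof. by apply/funext => i; rewrite /ord_cons; case: unliftP. Qed.

Lemma BnormZ {R : realType} {E : vectType R} (B : 'Hom(E, 'Hom(E, R^o)))
    (a : R) (u : E) :
  Bnorm B (a *: u) = `|a| * Bnorm B u.
Proof.
rewrite /Bnorm !linearZ /= lfunE /= /GRing.scale /= mulrA -expr2.
by rewrite sqrtrM ?sqr_ge0// sqrtr_sqr.
Qed.

Lemma BnormN {R : realType} {E : vectType R} (B : 'Hom(E, 'Hom(E, R^o))) (u : E) :
  Bnorm B (- u) = Bnorm B u.
Proof. by rewrite -scaleN1r BnormZ normrN1 mul1r. Qed.

Lemma Bnorm_eq0 {R : realType} {E : vectType R} (B : 'Hom(E, 'Hom(E, R^o))) (u : E) :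
  positive_definite B -> Bnorm B u = 0 -> u = 0.
Proof.
move=> Bp /eqP; rewrite sqrtr_eq0 => Bu; apply/eqP/negPn/negP => /Bp.
by rewrite ltNge Bu.
Qed.

(** Serves to parametrize a segment by arc length with a direction in the unit ball. For [v = 0] the
    direction is 0, and the range of [t] keeps the last clause true there. *)
Lemma Bnorm_polar {R : realType} {E : vectType R} (B : 'Hom(E, 'Hom(E, R^o))) (v : E) :
  positive_definite B -> exists u, [/\ Bnorm B u <= 1, v = Bnorm B v *: u &
    forall t, 0 <= t <= Bnorm B v -> Bnorm B (t *: u) = t].
Proof.
move=> Bp; have Bnorm0 : Bnorm B 0 = 0 by rewrite -(scale0r v) BnormZ normr0 mul0r.
have [v0|v0] := eqVneq (Bnorm B v) 0.
  exists 0; rewrite Bnorm0 scaler0 (Bnorm_eq0 _ _ Bp v0); split=> // t.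
  by rewrite scaler0 Bnorm0 -eq_le => /eqP.
have u1 : Bnorm B ((Bnorm B v)^-1 *: v) = 1.
  by rewrite BnormZ ger0_norm ?invr_ge0 ?sqrtr_ge0// mulVf.
exists ((Bnorm B v)^-1 *: v); split; first by rewrite u1.
  by rewrite scalerA mulfV// scale1r.
by move=> t /andP[t0 _]; rewrite BnormZ u1 mulr1 ger0_norm.
Qed.

(** * Taylor's formula on the domain under the Lipschitz assumption *)

Lemma lipschitz_derivative_le {R : realType} {E : vectType R}
    (B : 'Hom(E, 'Hom(E, R^o))) (X : set E) (p : nat)
    (Dp : E -> kform E p) (Lp : R) (x y : E) (h : 'I_p -> E) :
  lipschitz_derivative B X Dp Lp -> X x -> X y ->
  (forall i, Bnorm B (h i) <= 1) ->
  Dp x h - Dp y h <= Lp * Bnorm B (x - y).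
Proof.
move=> lip Xx Xy h1; rewrite -lee_fin.
by apply: le_trans (lip x y Xx Xy); apply: ereal_sup_ubound; exists h.
Qed.

(** The sign reduces both sides of the error to one upper bound: [taylor_le] is applied to the
    signed derivatives of [f] along the segment from [x] to [y], parametrized by arc length. *)
Lemma taylor_lipschitz_sign {R : realType} {E : vectType R}
    (B : 'Hom(E, 'Hom(E, R^o))) (X : set E) (f : E -> R) (p : nat)
    (D : forall k : nat, E -> kform E k) (Lp : R) (x y : E) (b : bool) :
  positive_definite B ->
  (forall x y (t : R), 0 <= t <= 1 -> X x -> X y -> X (t *: x + (1 - t) *: y)) ->
  derivatives_upto B X f p D -> lipschitz_derivative B X (D p) Lp ->
  X x -> X y ->
  (-1) ^+ b * (f y - (f x + \sum_(1 <= k < p.+1) (k`!%:R)^-1 * D k x (fun=> y - x)))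
    <= Lp * Bnorm B (y - x) ^+ p.+1 / (p.+1)`!%:R.
Proof.
move=> Bp Xconv [D0 Dm Dd] lip Xx Xy.
have [u [u1 yxE uN]] := Bnorm_polar B (y - x) Bp.
set N := Bnorm B (y - x) in yxE uN *.
have N0 : 0 <= N by exact: sqrtr_ge0.
have XN t : 0 <= t <= N -> X (x + t *: u).
  move=> /andP[t0 tN]; have [N00|Nn0] := eqVneq N 0.
    have -> : t = 0 by apply/eqP; rewrite eq_le t0 -{1}N00 tN.
    by rewrite scale0r addr0.
  have Np : 0 < N by rewrite lt_def Nn0.
  have -> : x + t *: u = (t / N) *: y + (1 - t / N) *: x.
    have -> : t *: u = (t / N) *: (y - x) by rewrite yxE scalerA divfK.
    by rewrite scalerBr scalerBl scale1r addrCA.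
  by apply: Xconv => //; rewrite divr_ge0//= ler_pdivrMr// mul1r.
pose g k t : R := (-1) ^+ b * D k (x + t *: u) (fun=> u).
(* After the Taylor coefficients at 0, the entry of index [p.+1] is [Lp], so the last term of the
   sum is the remainder. *)
pose a k : R := if (k <= p)%N then g k 0 else Lp.
have gx k : g k 0 = (-1) ^+ b * D k x (fun=> u) by rewrite /g scale0r addr0.
have := @taylor_le R N p g a.
have gD k : (k < p)%N -> derivative_on N (g k) (g k.+1).
  move=> kp t tN e e0.
  have [r r0 dr] := Dd k _ kp (XN t tN) e e0.
  exists r => // s sN sr.
  have stE : x + s *: u - (x + t *: u) = (s - t) *: u.
    by rewrite opprD addrACA subrr add0r scalerBl.
  have st : Bnorm B (x + s *: u - (x + t *: u)) <= `|s - t|.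
    by rewrite stE BnormZ ler_piMr.
  have := dr _ (XN s sN) (le_lt_trans st sr) (fun=> u) (fun=> u1).
  (* Pulling [s - t] out of the first argument leaves [D k.+1] evaluated on copies of [u]. *)
  rewrite {1}stE multilinear_ord_consZ; last exact: (Dm _ _ kp (XN t tN)).1.
  rewrite ord_cons_const /g -mulrA -!mulrBr normrMsign (mulrC _ (s - t)).
  by move=> /le_trans; apply; rewrite ler_wpM2l// ltW.
move=> /(_ gD) H.
have {}H := H _ _ N (introT andP (conj N0 (lexx N))).
have /H {}H : forall k, (k < p)%N -> g k 0 = a k by move=> k kp; rewrite /a ltnW.
have /H : forall t, 0 <= t <= N -> g p t <= a p + a p.+1 * t.
  move=> t tN; rewrite /a leqnn ltnn -lerBlDl.
  have t0 : 0 <= t by case/andP: tN.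
  rewrite gx /g -mulrBr.
  have xt : Bnorm B (x + t *: u - x) = t by rewrite addrC addKr uN.
  have tx : Bnorm B (x - (x + t *: u)) = t by rewrite -BnormN opprB.
  (* The two signs use the Lipschitz bound with its two points exchanged, since it controls signed
     differences. *)
  case: b {gD gx g a H} => /=; rewrite ?expr0 ?expr1 ?mul1r ?mulN1r ?opprB.
    by rewrite -[in leRHS]tx; exact: lipschitz_derivative_le lip Xx (XN t tN) _.
  by rewrite -[in leRHS]xt; exact: lipschitz_derivative_le lip (XN t tN) Xx _.
rewrite big_ord_recr /= {2}/a ltnn; have -> : g 0%N N = (-1) ^+ b * f y.
  by rewrite /g -yxE D0// addrC subrK.
rewrite mulrBr lerBlDl; have <- : \sum_(k < p.+1) a k * N ^+ k / k`!%:R =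
    (-1) ^+ b * (f x + \sum_(1 <= k < p.+1) (k`!%:R)^-1 * D k x (fun=> y - x)).
  rewrite big_ord_recl /= expr0 mulr1 divr1 big_add1 big_mkord mulrDr mulr_sumr.
  rewrite /a gx D0//; congr (_ + _); apply: eq_bigr => i _.
  rewrite /bump /= add1n ltn_ord gx yxE multilinear_diagZ; last first.
    exact: (Dm i.+1 x (ltn_ord i) Xx).1.
  by ring.
by [].
Qed.

Lemma taylor_lipschitz {R : realType} {E : vectType R}
    (B : 'Hom(E, 'Hom(E, R^o))) (X : set E) (f : E -> R) (p : nat)
    (D : forall k : nat, E -> kform E k) (Lp : R) (x y : E) :
  positive_definite B ->
  (forall x y (t : R), 0 <= t <= 1 -> X x -> X y -> X (t *: x + (1 - t) *: y)) ->
  derivatives_upto B X f p D -> lipschitz_derivative B X (D p) Lp ->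
  X x -> X y ->
  `|f y - (f x + \sum_(1 <= k < p.+1) (k`!%:R)^-1 * D k x (fun=> y - x))|
    <= Lp * Bnorm B (y - x) ^+ p.+1 / (p.+1)`!%:R.
Proof.
move=> Bp Xconv Df lip Xx Xy; rewrite ler_norml -lerNl.
have := taylor_lipschitz_sign B X f p D Lp x y true Bp Xconv Df lip Xx Xy.
have := taylor_lipschitz_sign B X f p D Lp x y false Bp Xconv Df lip Xx Xy.
by rewrite expr0 expr1 mul1r mulN1r => -> ->.
Qed.

(** * Composite objective and the inexact step *)

Lemma convex_ext_domain {R : realType} {E : vectType R} (psi : E -> \bar R)
    (x y : E) (t : R) :
  convex_ext psi -> 0 <= t <= 1 -> effective_domain psi x -> effective_domain psi y ->
  effective_domain psi (t *: x + (1 - t) *: y).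
Proof.
move=> psiC t01 px py; rewrite /effective_domain /=.
apply: le_lt_trans (psiC x y t t01) _; case/andP: t01 => t0 t1.
by rewrite lte_add_pinfty// lte_mul_pinfty ?lee_fin ?subr_ge0.
Qed.

(** Real-valued counterpart of [objective], for real arithmetic. As [fine] sends infinities to 0, it
    is meaningful only on the effective domain. *)
Definition real_objective {R : realType} {E : vectType R}
    (f : E -> R) (psi : E -> \bar R) (z : E) : R :=
  f z + fine (psi z).

Section composite.
Context {R : realType} {E : vectType R}.
Variables (B : 'Hom(E, 'Hom(E, R^o))) (psi : E -> \bar R) (f : E -> R).
Hypothesis psi_proper : proper_ext psi.
Hypothesis psi_convex : convex_ext psi.
Local Notation X := (effective_domain psi).
Local Notation F := (real_objective f psi).

Lemma fine_domainK (z : E) : X z -> (fine (psi z))%:E = psi z.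
Proof.
move=> Xz; rewrite fineK// fin_numE; apply/andP; split.
  by rewrite gt_eqF ?(psi_proper.1 z).
by rewrite lt_eqF.
Qed.

Lemma objective_domainE (z : E) : X z -> objective f psi z = (F z)%:E.
Proof. by move=> Xz; rewrite /objective -fine_domainK// -EFinD. Qed.

Lemma objective_convex (x y : E) (t : R) :
  convex_function X f -> 0 <= t <= 1 -> X x -> X y ->
  F (t *: x + (1 - t) *: y) <= t * F x + (1 - t) * F y.
Proof.
move=> fC t01 Xx Xy; have Xz := convex_ext_domain psi x y t psi_convex t01 Xx Xy.
have := psi_convex x y t t01.
rewrite -(fine_domainK _ Xx) -(fine_domainK _ Xy) -(fine_domainK _ Xz).
rewrite -!EFinM -EFinD lee_fin => hpsi.
case/andP: t01 => t0 t1.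
have : f (t *: x + (1 - t) *: y) <= t * f x + (1 - t) * f y.
  exact: (fC (Itv01 t0 t1) x y (mem_set Xx) (mem_set Xy)).
by rewrite /real_objective; lra.
Qed.

Variables (p : nat) (D : forall k : nat, E -> kform E k) (Lp : R).
Hypothesis B_pos : positive_definite B.
Hypothesis f_diff : derivatives_upto B X f p D.
Hypothesis Lp_lip : lipschitz_derivative B X (D p) Lp.

(** With [r] the bound on the Taylor error, [F T <= m T] because the regularization [p%:R * r T]
    dominates [r T], and [m y] exceeds [F y] by at most [p + 1] times [r y]. This factor turns
    [(p.+1)!] into [p!]. *)
Lemma inexact_step_le (delta : R) (x T y : E) :
  (1 <= p)%N -> inexact_step B f psi p D (p%:R * Lp) delta x T -> X x -> X y ->
  F T <= F y + Lp * Bnorm B (y - x) ^+ p.+1 / p`!%:R + delta.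
Proof.
move=> p1 [XT stepT] Xx Xy.
pose S z : R := \sum_(1 <= k < p.+1) (k`!%:R)^-1 * D k x (fun=> z - x).
pose r z : R := Lp * Bnorm B (z - x) ^+ p.+1 / (p.+1)`!%:R.
pose m z : R := f x + S z + p%:R * r z + fine (psi z).
have mE z : X z -> model B f psi p D (p%:R * Lp) x z = (m z)%:E.
  move=> Xz; rewrite /model -(fine_domainK _ Xz) -EFinD; congr (_%:E).
  by rewrite /m /r /S !mulrA.
have tay z : X z -> `|f z - (f x + S z)| <= r z.
  move=> Xz; apply: (taylor_lipschitz B X) => // a b t.
  exact: convex_ext_domain.
have mTy : m T <= m y + delta.
  move: stepT; rewrite (mE _ XT) => stepT.
  have infy : (ereal_inf (range (model B f psi p D (p%:R * Lp) x)) <= (m y)%:E)%E.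
    by apply: ereal_inf_lbound; exists y => //; rewrite mE.
  (* The bound by [m y] excludes the infimum [+oo] and the accuracy condition excludes [-oo], so
     only a real infimum remains. *)
  move: stepT infy; case: ereal_inf => [i| |] //=.
  by rewrite -EFinB !lee_fin; lra.
(* The sign of [Lp] is free, so this is read off from the absolute value that [r T] bounds. *)
have rT0 : 0 <= r T := le_trans (normr_ge0 _) (tay T XT).
have := tay T XT; have := tay y Xy; rewrite !ler_norml => /andP[ty _] /andP[_ tT].
have prT : r T <= p%:R * r T by rewrite ler_peMl// ler1n.
have -> : Lp * Bnorm B (y - x) ^+ p.+1 / p`!%:R = p%:R * r y + r y.
  rewrite -[X in _ = _ + X]mul1r -mulrDl natr1 /r factS natrM.
  by field; rewrite pnatr_eq0 -lt0n fact_gt0 addrC natr1 pnatr_eq0.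
by move: mTy; rewrite /m /real_objective; lra.
Qed.

End composite.

(** * Rate of decrease from a scalar recurrence *)

Lemma bernoulli_one_sub {R : realType} (a : R) (n : nat) :
  0 <= a <= 1 -> 1 - a *+ n <= (1 - a) ^+ n.
Proof.
move=> /andP[a0 a1]; elim: n => [|n IHn]; first by rewrite mulr0n subr0.
rewrite exprS; apply: le_trans (ler_wpM2l _ IHn); last by rewrite subr_ge0.
have an : 0 <= a *+ n by rewrite mulrn_wge0.
by rewrite mulrSr; nra.
Qed.

(** Each step adds at most the constant [p.+1%:R ^+ p.+1 * M + c] to the weighted value
    [k%:R ^+ p.+1 * u k]; after [k] steps, dividing by the weight leaves the power [p]. *)
Lemma tensor_rate {R : realType} (p : nat) (u : nat -> R) (M c : R) :
  0 <= M ->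
  (forall (k : nat) (t : R), 0 <= t <= 1 ->
     u k.+1 <= (1 - t) * u k + t ^+ p.+1 * M + c / k.+1%:R ^+ p.+1) ->
  forall k, (1 <= k)%N -> u k <= (p.+1%:R ^+ p.+1 * M + c) / k%:R ^+ p.
Proof.
move=> M0 uS k k1.
suff H : k%:R ^+ p.+1 * u k <= k%:R * (p.+1%:R ^+ p.+1 * M + c).
  have k0 : 0 < k%:R :> R by rewrite ltr0n.
  rewrite ler_pdivlMr ?exprn_gt0// -(ler_pM2l k0) (le_trans _ H)//.
  by rewrite exprS -mulrA (mulrC (u k)).
(* The induction starts at 0, where the weight vanishes, so the size of [u 0] does not enter the
   rate. *)
elim: k {k1} => [|k IHk]; first by rewrite expr0n /= !mul0r.
have k0 : 0 < k.+1%:R :> R by rewrite ltr0n.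
pose a : R := k.+1%:R^-1.
have a01 : 0 <= a <= 1.
  by rewrite invr_ge0 ltW//= invf_le1// ler1n.
have [a0 a1] := andP a01.
have ak : k%:R = k.+1%:R * (1 - a) :> R.
  by rewrite mulrBr mulr1 mulfV ?gt_eqF// -natr1 addrK.
have pow01 : 0 <= (1 - a) ^+ p.+1 <= 1.
  by rewrite exprn_ge0 ?subr_ge0//= exprn_ile1 ?subr_ge0// lerBlDr lerDl.
(* Since [1 - a] is [k / (k + 1)], the new weight times [1 - t] is the old weight; for [k = 0] this
   means [t = 1]. *)
pose t := 1 - (1 - a) ^+ p.+1.
have t01 : 0 <= t <= 1 by rewrite /t; move: pow01 => /andP[? ?]; lra.
have [t0 _] := andP t01.
have ta : t <= a *+ p.+1.
  by rewrite /t; have := bernoulli_one_sub a p.+1 a01; lra.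
have tM : k.+1%:R ^+ p.+1 * (t ^+ p.+1 * M) <= p.+1%:R ^+ p.+1 * M.
  rewrite mulrA -exprMn ler_wpM2r// lerXn2r ?nnegrE ?mulr_ge0 ?(ltW k0)//.
  by rewrite (le_trans (ler_wpM2l (ltW k0) ta))// mulrnAr mulfV ?gt_eqF.
have tE : 1 - t = (1 - a) ^+ p.+1 by rewrite /t subKr.
have kE : k.+1%:R ^+ p.+1 * ((1 - a) ^+ p.+1 * u k) = k%:R ^+ p.+1 * u k.
  by rewrite mulrA -exprMn -ak.
have := ler_wpM2l (exprn_ge0 p.+1 (ltW k0)) (uS k t t01).
rewrite !mulrDr tE kE.
have -> : k.+1%:R ^+ p.+1 * (c / k.+1%:R ^+ p.+1) = c.
  by rewrite mulrCA mulfV ?mulr1// expf_neq0 ?gt_eqF.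
have -> : k.+1%:R * (p.+1%:R ^+ p.+1 * M) + k.+1%:R * c =
    k%:R * (p.+1%:R ^+ p.+1 * M + c) + p.+1%:R ^+ p.+1 * M + c.
  by rewrite -natr1; ring.
by move: IHk tM; lra.
Qed.

(** * Convergence rate of the monotone method *)

Theorem theorem1 (R : realType) (E : vectType R)
    (B : 'Hom(E, 'Hom(E, R^o)))
    (B_sym : self_adjoint B) (B_pos : positive_definite B)
    (p : nat) (p_ge1 : (1 <= p)%N)
    (psi : E -> \bar R)
    (psi_proper : proper_ext psi) (psi_closed : closed_ext B psi)
    (psi_convex : convex_ext psi)
    (f : E -> R) (f_convex : convex_function (effective_domain psi) f)
    (D : forall k : nat, E -> kform E k)
    (f_diff : derivatives_upto B (effective_domain psi) f p D)
    (Lp : R) (Lp_lip : lipschitz_derivative B (effective_domain psi) (D p) Lp)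
    (xs : E) (xs_sol : is_solution f psi xs)
    (c : R) (c_ge0 : 0 <= c)
    (delta : nat -> R)
    (delta_rule : forall k : nat, (1 <= k)%N -> delta k = c / k%:R ^+ p.+1)
    (x T : nat -> E)
    (x_method : monotone_inexact_tensor_method_I B f psi p D Lp delta x T)
    (radius : R)
    (radiusE : level_set_radius B f psi (x 0%N) xs = radius%:E) :
  forall k : nat, (1 <= k)%N ->
    (objective f psi (x k) - objective f psi xs <=
       ((p.+1)%:R ^+ p.+1 * Lp * radius ^+ p.+1 / (p`!%:R * k%:R ^+ p)
        + c / k%:R ^+ p)%:E)%E.
Proof.
have [xs_dom xs_min] := xs_sol.
have [x0_dom x_step] := x_method.
pose X := effective_domain psi.
pose F := real_objective f psi.
have objE z : X z -> objective f psi z = (F z)%:E by exact: objective_domainE.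
(* Monotonicity keeps the iterates in the domain and in the initial level set, so that [radius]
   bounds their distances to [xs]. *)
have x_inv k : X (x k) /\ F (x k) <= F (x 0%N).
  elim: k => [//|k [IHX IHF]]; have [[XT _] ->] := x_step k.
  rewrite !objE// lte_fin; case: ifP => // FT.
  by split=> //; rewrite (le_trans (ltW FT)).
have x_dom k : X (x k) := (x_inv k).1.
have x_mono k : F (x k.+1) <= F (T k.+1).
  have [[XT _] ->] := x_step k.
  by rewrite !objE// lte_fin; case: ifP => // /negbT; rewrite -leNgt.
have x_radius k : Bnorm B (x k - xs) <= radius.
  rewrite -lee_fin -radiusE; apply: ereal_sup_ubound; exists (x k) => //=.
  by rewrite !objE// lee_fin (x_inv k).2.
have radius0 : 0 <= radius := le_trans (sqrtr_ge0 _) (x_radius 0%N).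
(* Lp may be negative when the domain is a single point. *)
have Lp_neg z : Lp < 0 -> X z -> Bnorm B (z - xs) = 0.
  move=> L0 Xz; apply/eqP; rewrite eq_le sqrtr_ge0 andbT leNgt; apply/negP => zxs.
  (* This bounds the absolute Taylor error from [xs] to [z], yet it would be negative for [Lp < 0]
     at a positive distance. *)
  have : 0 <= Lp * Bnorm B (z - xs) ^+ p.+1 / (p.+1)`!%:R.
    apply: le_trans (normr_ge0 _) (taylor_lipschitz B X f p D Lp xs z _ _ _ _ _ _) => //.
    by move=> a b t; exact: convex_ext_domain.
  rewrite leNgt => /negP; apply.
  by rewrite pmulr_llt0 ?invr_gt0 ?ltr0n ?fact_gt0// pmulr_llt0// exprn_gt0.
(* The initial level set lies in the domain, whose points are then all at distance 0 from [xs]. *)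
have radius_neg : Lp < 0 -> radius = 0.
  move=> L0; apply/eqP; rewrite eq_le radius0 andbT -lee_fin -radiusE.
  apply: ge_ereal_sup => _ [z /= zx0 <-]; rewrite lee_fin Lp_neg//.
  rewrite /X /effective_domain /=; move: zx0; rewrite (objE _ x0_dom) /objective.
  by case: (psi z) => [?||] //=; rewrite ltry.
have M_ge0 : 0 <= Lp * radius ^+ p.+1 / p`!%:R.
  rewrite divr_ge0 ?ler0n//; have [L0|L0] := leP 0 Lp.
    by rewrite mulr_ge0 ?exprn_ge0.
  by rewrite radius_neg// expr0n mulr0.
have x_M k : Lp * Bnorm B (x k - xs) ^+ p.+1 / p`!%:R <= Lp * radius ^+ p.+1 / p`!%:R.
  rewrite ler_wpM2r ?invr_ge0 ?ler0n//; have [L0|L0] := leP 0 Lp.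
    by rewrite ler_wpM2l// lerXn2r ?nnegrE ?sqrtr_ge0.
  by rewrite radius_neg// Lp_neg.
move=> k k_ge1; rewrite !objE// -EFinB lee_fin.
have := @tensor_rate R p (fun k => F (x k) - F xs) (Lp * radius ^+ p.+1 / p`!%:R) c M_ge0.
have uS n (t : R) : 0 <= t <= 1 -> F (x n.+1) - F xs <=
    (1 - t) * (F (x n) - F xs) + t ^+ p.+1 * (Lp * radius ^+ p.+1 / p`!%:R)
      + c / n.+1%:R ^+ p.+1.
  move=> t01; have [t0 t1] := andP t01.
  (* The competitor lies at the fraction [t] of the way from [x n] to [xs]; its distance to [x n]
     carries the factor [t], hence the power [t ^+ p.+1]. The value of [t] stays free until
     [tensor_rate] picks it. *)
  pose y := t *: xs + (1 - t) *: x n.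
  have Xy : X y := convex_ext_domain psi xs (x n) t psi_convex t01 xs_dom (x_dom n).
  have Fy : F y <= t * F xs + (1 - t) * F (x n) :=
    objective_convex psi f psi_proper psi_convex xs (x n) t f_convex t01 xs_dom (x_dom n).
  have yx : Bnorm B (y - x n) = t * Bnorm B (x n - xs).
    have -> : y - x n = t *: (xs - x n).
      by rewrite /y scalerBl scale1r scalerBr addrCA (addrC (x n)) addrK.
    by rewrite BnormZ ger0_norm// -BnormN opprB.
  have := inexact_step_le B psi f psi_proper psi_convex p D Lp B_pos f_diff Lp_lip _ _ _ _
    p_ge1 (x_step n).1 (x_dom n) Xy.
  rewrite -/F yx delta_rule// exprMn.
  have := ler_wpM2l (exprn_ge0 p.+1 t0) (x_M n).
  have -> : Lp * (t ^+ p.+1 * Bnorm B (x n - xs) ^+ p.+1) / p`!%:R =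
    t ^+ p.+1 * (Lp * Bnorm B (x n - xs) ^+ p.+1 / p`!%:R) by ring.
  by move: (x_mono n) Fy; lra.
move=> /(_ uS k k_ge1) /le_trans; apply.
rewrite le_eqVlt; apply/orP; left; apply/eqP.
by rewrite invfM; ring.
Qed.
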